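(* Let $n,m\ge1$ and let $A=\{x^{(1)},\dots,x^{(m)}\}$ be a finite subset of $\mathbb{R}^n$. Then there exist $m$ finite subsets $I_1,\dots,I_m$ of $\mathbb{N}$ such that $$Co^\infty(A)\subset\Big\{\boxplus_{j\in[m],\,k\in I_j}\,t_{j,k}\,x^{(j)}\;:\;t_{j,k}\in\mathbb{R},\ \boxplus_{k\in I_j}t_{j,k}\ge0\ \text{ for every } j\in[m],\ \max_{j\in[m],\,k\in I_j}t_{j,k}=1\Big\}.$$
   Context: Notation: $\mathbb{N}=\{0,1,2,\dots\}$ and $[m]=\{1,\dots,m\}$. For $p\in\mathbb{N}$ let $\varphi_p(\lambda)=\lambda^{2p+1}$, a bijection of $\mathbb{R}$, and let $\phi_p:\mathbb{R}^n\to\mathbb{R}^n$ be its componentwise version. For a finite set $A\subset\mathbb{R}^n$, $Co^p(A)=\phi_p^{-1}\big(Co(\phi_p(A))\big)$, where $Co$ is the usual convex hull (so $Co^p(\emptyset)=\emptyset$). For a sequence of sets $A^{(p)}\subset\mathbb{R}^n$, the Painlevé–Kuratowski upper limit $\mathrm{Ls}_{p\to\infty}A^{(p)}$ is the set of limits of convergent sequences $x^{(p_k)}\in A^{(p_k)}$ along subsequences $(p_k)$. Define $Co^\infty(A)=\mathrm{Ls}_{p\to\infty}Co^p(A)$. For a finite family $(u_i)_{i\in I}$ of real numbers, $\boxplus_{i\in I}u_i=\lim_{p\to\infty}\big(\sum_{i\in I}u_i^{2p+1}\big)^{1/(2p+1)}$. Explicitly, for $\alpha>0$ put $\xi(\alpha)=\mathrm{Card}\{i:u_i=\alpha\}-\mathrm{Card}\{i:u_i=-\alpha\}$;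 the value is $0$ if $\xi\equiv 0$ (in particular for the empty family), and otherwise it is $\alpha^*$ or $-\alpha^*$ according to whether $\xi(\alpha^* )>0$ or $\xi(\alpha^* )<0$, where $\alpha^*$ is the largest $\alpha>0$ with $\xi(\alpha)\neq0$. For vectors $\boxplus$ is applied componentwise. The operation is not associative: $\boxplus_{j\in[m],k\in I_j}$ denotes the single operation applied to the whole family indexed by the pairs $(j,k)$. *)

(* Defs.v *)
From HB Require Import structures.
From mathcomp Require Import all_boot all_order all_algebra finmap.
From mathcomp Require Import all_classical all_reals all_analysis.

Set Implicit Arguments.
Unset Strict Implicit.
Unset Printing Implicit Defensive.

Import Order.TTheory GRing.Theory Num.Theory.
Import numFieldNormedType.Exports.

Local Open Scope classical_set_scope.
Local Open Scope ring_scope.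

Definition oddpow {R : realType} (p : nat) (a : R) : R := a ^+ (2 * p + 1).

(* The real (2p+1)-th root. As [`^] is only meaningful on nonnegative bases,
   the sign is handled separately. *)
Definition oddroot {R : realType} (p : nat) (a : R) : R :=
  Num.sg a * `|a| `^ ((2 * p + 1)%:R)^-1.

Lemma sgrX_odd {R : realType} (p : nat) (a : R) :
  Num.sg a ^+ (2 * p + 1) = Num.sg a.
Proof.
have [->|a0] := eqVneq a 0; first by rewrite sgr0 addn1 exprS mul0r.
by rewrite sgr_odd// addn1 oddS mul2n odd_double.
Qed.

Lemma oddrootK {R : realType} (p : nat) : cancel (@oddroot R p) (oddpow p).
Proof.
move=> a; rewrite /oddpow /oddroot exprMn.
by rewrite sgrX_odd -powR_mulrn ?powR_ge0// -powRrM mulVf ?powRr1 -?numEsg//.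
Qed.

Lemma oddpowK {R : realType} (p : nat) : cancel (@oddpow R p) (oddroot p).
Proof.
move=> a; rewrite /oddpow /oddroot sgrX normrX.
by rewrite sgrX_odd -powR_mulrn// -powRrM mulfV ?powRr1 -?numEsg//.
Qed.

Definition oddpow_row {R : realType} {n : nat} (p : nat) : 'rV[R]_n -> 'rV[R]_n :=
  map_mx (oddpow p).

Definition convex_hull {R : realType} {n : nat} (A : set 'rV[R]_n) :
  set 'rV[R]_n := smallest (@convex_set R 'rV[R]_n) A.

Definition Cop {R : realType} {n : nat} (p : nat) (A : set 'rV[R]_n) :
  set 'rV[R]_n := oddpow_row p @^-1` convex_hull (oddpow_row p @` A).

(* Painleve-Kuratowski upper limit *)
Definition upper_limit {T : topologicalType} (A : nat -> set T) : set T :=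
  [set x | exists (q : nat -> nat) (y : nat -> T),
    [/\ increasing_seq q, forall k, A (q k) (y k) & y @ \oo --> x]].

Definition Co_infty {R : realType} {n : nat} (A : set 'rV[R]_n) :
  set 'rV[R]_n := upper_limit (fun p => Cop p A).

Definition boxplus {R : realType} {I : finType} (u : I -> R) : R :=
  limn (fun p => oddroot p (\sum_(i : I) oddpow p (u i))).

Definition boxplus_row {R : realType} {n : nat} {I : finType}
  (u : I -> 'rV[R]_n) : 'rV[R]_n := \row_i boxplus (fun k => u k ord0 i).

(* [a] is the maximum of the family [u]; an empty family has none. *)
Definition is_max_of {R : realType} {I : finType} (u : I -> R) (a : R) : Prop :=
  (exists i, u i = a) /\ (forall i, u i <= a).

(* Main.v *)
Require Import Defs.
From HB Require Import structures.
From mathcomp Require Import all_boot all_order all_algebra finmap.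
From mathcomp Require Import all_classical all_reals all_analysis.
From mathcomp Require Import perm zify ring lra.
Import Order.TTheory GRing.Theory Num.Theory.
Import numFieldNormedType.Exports.
Local Open Scope classical_set_scope.
Local Open Scope ring_scope.

(** Why the inclusion holds.

    Write P = 2p+1.  A point z of Co^p(A) is given by a vector of weights l >= 0
    with sum 1 such that z_i^P = sum_j l_j (x_ji)^P for every coordinate i.  Along
    a sequence z^(k) -> y with exponents tending to infinity, the number
    y_i = lim (sum_j l_j x_ji^P)^(1/P) remembers only the exponential growth rate
    of that sum.  The difficulty is cancellation: the rate of the sum is not
    determined by the rates of its terms, so the limits of the l_j^(1/P) do not
    determine y.

    The way around it is to cut the weights into pieces that never cancel.  Let s
    record the signs of the coordinates of z^(k), made constant by an
    ultrafilter.  Then l lies in the pointed polyhedral cone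
        l_j >= 0,   (-1)^s_i sum_j l_j (x_ji)^P >= 0,
    hence it is a nonnegative combination l = sum_r c_r ray_r of finitely many
    extremal rays ([ray_decomposition]).  A ray is a vector of cofactors of a
    square matrix whose entries are P-th powers of reals that do not depend on P;
    by the Leibniz formula each entry of a ray is therefore a sum of P-th powers
    of fixed real numbers, one for each permutation ([ray_oddpow]).  As all the
    rays used lie in the cone, the sums sum_j (ray_r)_j x_ji^P have the same sign
    for all r, and for nonnegative sequences the growth rate of a sum is the
    maximum of the growth rates ([cvg_oddroot_sum]).  So replacing c_r by g_r^P,
    where g_r is the limit of c_r^(1/P), changes no growth rate
    ([oddroot_ray_limits]).  The new weights are
        N_j(p) = sum_(r, sigma) (g_r * monomial_(r, j, sigma))^P,
    and the numbers g_r * monomial_(r, j, sigma) are the coefficients t_(j, k) of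
    the statement, up to one correction: pairs of opposite coefficients with a
    large absolute value may occur, which would spoil the condition on the
    maximum.  Deleting such pairs ([oddpow_sum_reduce]) makes the largest
    coefficient equal to the growth rate of sum_j N_j(p), which is 1 because the
    weights l_j have sum 1.

    The index set of the coefficients, pairs of a candidate ray and a
    permutation, depends only on m and n; this is what makes the sets I_j
    independent of y. *)

(** * Extremal rays of a pointed polyhedral cone *)

Definition in_cone {R : realFieldType} {q m : nat} (W : 'M[R]_(q, m))
    (l : 'cV[R]_m) : Prop :=
  forall r, 0 <= (W *m l) r 0.

(** A candidate ray is given by the rows of the system that it makes tight and by
    an orientation.  Rows may repeat; the ray is then zero. *)
Definition rayidx (q m : nat) : finType := ({ffun 'I_m -> 'I_q} * bool)%type.

Definition ray_mx {R : pzRingType} {q m : nat} (W : 'M[R]_(q, 1 + m))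
    (r : rayidx q m) (v : 'rV[R]_(1 + m)) : 'M[R]_(1 + m) :=
  col_mx ((-1) ^+ r.2 *: v) (rowsub r.1 W).

(** The cofactors of the first row of [ray_mx W r v], that is, the generalized cross
    product of the selected rows, signed by the orientation.  The full-size
    determinants, whose first row is a signed unit vector, make each entry a sum
    of products of entries of [W] (up to signs, 0 and 1). *)
Definition ray {R : comPzRingType} {q m : nat} (W : 'M[R]_(q, 1 + m))
    (r : rayidx q m) : 'cV[R]_(1 + m) :=
  \col_j \det (ray_mx W r (delta_mx 0 j)).

Lemma det_col_mx_row {R : comPzRingType} {m : nat} (v : 'rV[R]_(1 + m))
    (B : 'M[R]_(m, 1 + m)) :
  \det (col_mx v B) =
  \sum_c v 0 c * cofactor (col_mx 0 B) (@lshift 1 m 0) c.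
Proof.
rewrite (expand_det_row _ (@lshift 1 m 0)); apply: eq_bigr => c _.
rewrite (@col_mxEu _ 1 m) /cofactor; congr (_ * (_ * \det _)).
apply/matrixP => a b; rewrite !mxE.
have [k ->] : exists k : 'I_m, lift (@lshift 1 m 0) a = @rshift 1 m k.
  by exists a; apply: val_inj; rewrite /= /bump leq0n.
by rewrite -[rshift 1 k]/(unsplit (inr k)) unsplitK.
Qed.

Lemma mul_ray {R : comPzRingType} {q m : nat} (W : 'M[R]_(q, 1 + m))
    (r : rayidx q m) (v : 'rV[R]_(1 + m)) :
  (v *m ray W r) 0 0 = \det (ray_mx W r v).
Proof.
rewrite /ray_mx det_col_mx_row mxE; apply: eq_bigr => c _.
rewrite !mxE det_col_mx_row (bigD1 c)//= big1 ?addr0 => [|d dc].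
  by rewrite !mxE !eqxx mulr1 mulrCA mulrA.
by rewrite !mxE (negbTE dc) andbF mulr0 mul0r.
Qed.

Lemma row_mul_ray {R : comPzRingType} {q m : nat} (W : 'M[R]_(q, 1 + m))
    (r : rayidx q m) (a : 'I_m) :
  (W *m ray W r) (r.1 a) 0 = 0.
Proof.
have -> : (W *m ray W r) (r.1 a) 0 = (row (r.1 a) W *m ray W r) 0 0.
  by rewrite -row_mul [RHS]mxE.
rewrite mul_ray /ray_mx det_col_mx_row.
under eq_bigr => c _ do rewrite mxE -mulrA.
rewrite -mulr_sumr -det_col_mx_row.
rewrite (@determinant_alternate _ _ _ (@lshift 1 m 0) (@rshift 1 m a)) ?mulr0//.
by move=> c; rewrite (@col_mxEu _ 1 m) (@col_mxEd _ 1 m) !mxE.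
Qed.

(** Loose rows are zeroed rather than removed, so that the row indices of [W] are
    kept. *)
Definition tight_mx {R : realFieldType} {q m : nat} (W : 'M[R]_(q, m))
    (l : 'cV[R]_m) : 'M[R]_(q, m) :=
  \matrix_(r, c) if (W *m l) r 0 == 0 then W r c else 0.

Lemma tight_mxE {R : realFieldType} {q m p : nat} (W : 'M[R]_(q, m))
    (l : 'cV[R]_m) (u : 'M[R]_(m, p)) r c :
  (tight_mx W l *m u) r c = if (W *m l) r 0 == 0 then (W *m u) r c else 0.
Proof.
rewrite mxE; case: ifP => rt.
  by rewrite mxE; apply: eq_bigr => k _; rewrite mxE rt.
by rewrite big1 // => k _; rewrite mxE rt mul0r.
Qed.

Lemma cV_norm2_gt0 {R : realFieldType} {m : nat} (l : 'cV[R]_m) :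
  l != 0 -> 0 < (l^T *m l) 0 0.
Proof.
move=> l0; rewrite lt_neqAle eq_sym mxE.
have ge0 (i : 'I_m) : true -> 0 <= l^T 0 i * l i 0.
  by rewrite mxE -expr2 sqr_ge0.
rewrite sumr_ge0// andbT; apply: contra l0 => /eqP/psumr_eq0P-/(_ ge0) E.
apply/eqP/matrixP => i j; rewrite ord1 [RHS]mxE.
by have := E i isT; rewrite mxE => /eqP; rewrite mulf_eq0 orbb => /eqP.
Qed.

(** If the tight constraints at [l] leave only the line of [l], they have corank 1;
    a maximal independent selection of them, completed by [l] as first row, is
    invertible, and [l] and the cross product of the selection have proportional
    images under that matrix. *)
Lemma extremal_ray {R : realFieldType} {q m : nat} (W : 'M[R]_(q, 1 + m))
    (l : 'cV[R]_(1 + m)) :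
  l != 0 ->
  (forall u : 'cV_(1 + m), tight_mx W l *m u = 0 -> exists c, u = c *: l) ->
  exists r c, 0 < c /\ l = c *: ray W r.
Proof.
move=> l0 kerl; set A := tight_mx W l.
have Al : A *m l = 0.
  by apply/matrixP => r c; rewrite tight_mxE ord1 [RHS]mxE; case: ifP => // /eqP.
have rkl : \rank l^T = 1%N by rewrite rank_rV -trmx0 (inj_eq trmx_inj) l0.
have rkA : \rank A = m.
  have : (kermx A^T == l^T)%MS.
    apply/andP; split; last by apply/sub_kermxP; rewrite -trmx_mul Al trmx0.
    apply/row_subP => i; have /kerl[c Ec] : A *m (row i (kermx A^T))^T = 0.
      by apply: trmx_inj; rewrite trmx_mul trmxK -row_mul mulmx_ker row0 trmx0.
    by rewrite -[row i _]trmxK Ec linearZ/= scalemx_sub.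
  move/eqmx_rank; rewrite rkl mxrank_ker mxrank_tr => E.
  by have := rank_leq_col A; lia.
have [g gf] : exists g : 'I_m -> 'I_q, row_free (rowsub g A).
  move: (maxrankfun A) (maxrowsub_free A); rewrite rkA => g gf.
  by exists g.
have gt a : (W *m l) (g a) 0 == 0.
  apply: contraT => ng.
  have E : (delta_mx 0 a : 'rV_m) *m rowsub g A = 0.
    rewrite -rowE; apply/matrixP => i j.
    rewrite /A [LHS]mxE [LHS]mxE. 
    by rewrite [LHS]mxE (negbTE ng) [RHS]mxE.
  have /matrixP/(_ 0 a) := row_free_inj gf (etrans E (esym (mul0mx _ _))).
  by rewrite !mxE !eqxx => /eqP; rewrite oner_eq0.
have gA : rowsub g A = rowsub g W.
  by apply/matrixP => i j; rewrite /A [LHS]mxE [LHS]mxE gt [RHS]mxE.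
(* Invertible because l is orthogonal to the selected rows. *)
pose M : 'M[R]_(1 + m) := col_mx l^T (rowsub g W).
have n0 := cV_norm2_gt0 l l0.
have gWl : rowsub g W *m l = 0.
  apply/matrixP => i j; rewrite -gA ord1 mul_rowsub_mx Al.
  by rewrite !mxE.
have Mu : M \in unitmx.
  rewrite -row_free_unit -kermx_eq0; apply/eqP/row_matrixP => i.
  rewrite row0; set v := row i _.
  have : v *m M = 0 by rewrite /v -row_mul mulmx_ker row0.
  rewrite -[v](@hsubmxK _ 1 1 m) /M (@mul_row_col _ 1 1 m).
  set v0 := lsubmx _; set v1 := rsubmx _ => E.
  have v00 : v0 = 0.
    have := congr1 (fun z => z *m l) E.
    rewrite mulmxDl -!mulmxA gWl mulmx0 addr0 mul0mx.
    rewrite [l^T *m l]mx11_scalar mul_mx_scalar => /eqP.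
    by rewrite scaler_eq0 gt_eqF//= => /eqP.
  move: E; rewrite v00 mul0mx add0r -gA => E.
  rewrite (row_free_inj gf (etrans E (esym (mul0mx _ _)))).
  by rewrite row_mx0.
pose n := (l^T *m l) 0 0.
have detM : \det M != 0 by rewrite -unitfE.
pose b := \det M < 0.
pose r : rayidx q m := ([ffun i => g i], b).
have er : ray_mx W r l^T = col_mx ((-1) ^+ b *: l^T) (rowsub g W).
  rewrite /ray_mx/=; congr (col_mx _ _).
  by apply/matrixP => i j; rewrite !mxE ffunE.
have dr : \det (ray_mx W r l^T) = `|\det M|.
  rewrite er det_col_mx_row.
  under eq_bigr => c _ do rewrite mxE -mulrA.
  by rewrite -mulr_sumr -det_col_mx_row normrEsign.
exists r, (n / `|\det M|); split; first by rewrite divr_gt0 ?normr_gt0.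
have gWr : rowsub g W *m ray W r = 0.
  apply/matrixP => a j; rewrite mul_rowsub_mx ord1 [LHS]mxE [RHS]mxE.
  by have := row_mul_ray W r a; rewrite /r/= ffunE.
rewrite -[LHS](mulKmx Mu) -[RHS](mulKmx Mu); congr (_ *m _).
rewrite -scalemxAr /M !mul_col_mx gWl gWr (@scale_col_mx _ 1 m) scaler0.
congr (col_mx _ _); apply/matrixP => i j; rewrite !ord1 [RHS]mxE mul_ray dr.
by rewrite -mulrA mulVf ?mulr1// normr_eq0.
Qed.

(** Minkowski's theorem for pointed cones.  Induction on the number of loose
    constraints: if some direction [w] not parallel to [l] keeps the tight constraints
    tight, it can be chosen with zero coordinate sum, so the cone contains neither
    [w] nor [- w]; walking from [l] both ways then ends on smaller faces, and [l]
    is a convex combination of the two end points. *)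
Lemma ray_decomposition {R : realFieldType} {q m : nat} (W : 'M[R]_(q, 1 + m))
    (W_pointed : forall u, in_cone W u -> forall j, 0 <= u j 0)
    (l : 'cV[R]_(1 + m)) :
  in_cone W l ->
  exists c : rayidx q m -> R,
    [/\ forall r, 0 <= c r,
        forall r, c r != 0 -> ray W r != 0 /\ in_cone W (ray W r)
      & l = \sum_r c r *: ray W r].
Proof.
pose gen (u : 'cV[R]_(1 + m)) := exists c : rayidx q m -> R,
    [/\ forall r, 0 <= c r,
        forall r, c r != 0 -> ray W r != 0 /\ in_cone W (ray W r)
      & u = \sum_r c r *: ray W r].
have genD u v : gen u -> gen v -> gen (u + v).
  move=> [c [c0 c1 ->]] [d [d0 d1 ->]]; exists (fun r => c r + d r); split.
  - by move=> r; rewrite addr_ge0.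
  - move=> r; have [-> |/c1//] := eqVneq (c r) 0.
    by rewrite add0r => /d1.
  - by rewrite -big_split/=; apply: eq_bigr => r _; rewrite scalerDl.
have genZ a u : 0 <= a -> gen u -> gen (a *: u).
  move=> a0 [c [c0 c1 ->]]; exists (fun r => a * c r); split.
  - by move=> r; rewrite mulr_ge0.
  - by move=> r; rewrite mulf_eq0 negb_or => /andP[_ /c1].
  - by rewrite scaler_sumr; apply: eq_bigr => r _; rewrite scalerA.
pose slack (u : 'cV[R]_(1 + m)) := #|[pred r | (W *m u) r 0 != 0]|.
suff H k u : (slack u < k)%N -> in_cone W u -> gen u by apply: (H (slack l).+1).
elim: k u => // k IH u uk uC.
have [-> |u0] := eqVneq u 0.
  exists (fun=> 0); split => // [r|]; first by rewrite eqxx.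
  by rewrite big1// => r _; rewrite scale0r.
have [kerl|] := pselect (forall v : 'cV_(1 + m),
    tight_mx W u *m v = 0 -> exists c, v = c *: u).
  have [r0 [c [c0 E]]] := extremal_ray W u u0 kerl.
  exists (fun r => if r == r0 then c else 0); split.
  - by move=> r; case: ifP => // _; exact: ltW.
  - move=> r; case: ifP => [/eqP-> _|]; last by rewrite eqxx.
    split; first by apply: contra u0 => /eqP r00; rewrite E r00 scaler0.
    move=> a; rewrite -(pmulr_rge0 _ c0).
    by have := uC a; rewrite {1}E -scalemxAr mxE.
  - rewrite (bigD1 r0)//= eqxx big1 ?addr0// => r /negbTE->.
    by rewrite scale0r.
move=> /existsNP[v /not_implyP[Av vu]].
pose s (w : 'cV[R]_(1 + m)) := \sum_i w i 0.
have uge0 := W_pointed u uC.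
have su : 0 < s u.
  rewrite lt_neqAle eq_sym sumr_ge0 ?andbT//.
  apply: contra u0 => /eqP/psumr_eq0P E; apply/eqP/matrixP => i j.
  by rewrite ord1 mxE E.
pose w := v - (s v / s u) *: u.
have Aw : tight_mx W u *m w = 0.
  rewrite mulmxBr Av sub0r -scalemxAr; apply/matrixP => r j.
  rewrite ord1 [LHS]mxE [X in - X]mxE tight_mxE [RHS]mxE.
  by case: ifP => [/eqP->|_]; rewrite mulr0 oppr0.
have w0 : w != 0.
  by apply/eqP => /eqP; rewrite subr_eq0 => /eqP E; apply: vu; exists (s v / s u).
have sw : s w = 0.
  have -> : s w = s v - (s v / s u) * s u.
    by rewrite /s mulr_sumr -sumrB; apply: eq_bigr => i _; rewrite !mxE.
  by rewrite divfK ?subrr// gt_eqF.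
have move_to_face z : tight_mx W u *m z = 0 -> (exists j, z j 0 < 0) ->
    exists2 t : R, 0 < t & gen (u + t *: z).
  move=> Az [j zj].
  have tz r : (W *m u) r 0 = 0 -> (W *m z) r 0 = 0.
    move=> ur; have /matrixP/(_ r 0) := Az.
    by rewrite tight_mxE ur eqxx [RHS]mxE.
  have [r0 r0z] : exists r, (W *m z) r 0 < 0.
    apply: contrapT => /forallNP N.
    suff /W_pointed/(_ j) : in_cone W z by rewrite leNgt zj.
    by move=> r; rewrite leNgt; apply/negP/N.
  pose P := [pred r | (W *m z) r 0 < 0].
  pose F r := (W *m u) r 0 / - (W *m z) r 0.
  have Pr0 : P r0 by [].
  case: (arg_minP F Pr0) => r1 Pr1 mn.
  have zr1 : 0 < - (W *m z) r1 0 by rewrite oppr_gt0.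
  have ur1 : 0 < (W *m u) r1 0.
    rewrite lt_neqAle uC andbT eq_sym; apply/eqP => /tz E.
    by move: Pr1; rewrite /P/= E ltxx.
  exists (F r1); first by rewrite divr_gt0.
  have WE r : (W *m (u + F r1 *: z)) r 0 = (W *m u) r 0 + F r1 * (W *m z) r 0.
    by rewrite mulmxDr -scalemxAr mxE; congr (_ + _); rewrite mxE.
  apply: IH.
    apply: (@leq_trans (slack u)) => //; apply: proper_card; apply/properP; split.
      apply/fintype.subsetP => r; rewrite !inE WE; apply: contra => /eqP ur.
      by rewrite ur tz// mulr0 addr0.
    exists r1; rewrite !inE; first by rewrite gt_eqF.
    by rewrite negbK WE /F -mulrA invrN mulNr mulVf ?mulrN ?mulr1 ?subrr// lt_eqF.
  move=> r; rewrite WE; have [zr|zr] := ltP ((W *m z) r 0) 0.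
    have := mn r zr; rewrite /F ler_pdivlMr ?oppr_gt0//.
    by rewrite mulrN; lra.
  by rewrite addr_ge0// mulr_ge0// ltW// divr_gt0.
have neg z : s z = 0 -> z != 0 -> exists j, z j 0 < 0.
  move=> sz z0; apply: contrapT => /forallNP N.
  move/negP: z0; apply; apply/eqP/matrixP => i j; rewrite ord1 [RHS]mxE.
  by move/psumr_eq0P: sz; apply=> // a _; rewrite leNgt; apply/negP/N.
have [t1 t10 g1] := move_to_face w Aw (neg w sw w0).
have [t2 t20 g2] : exists2 t : R, 0 < t & gen (u + t *: - w).
  apply: move_to_face; first by rewrite mulmxN Aw oppr0.
  apply: neg; last by rewrite oppr_eq0.
  by rewrite -[RHS]oppr0 -sw /s -sumrN; apply: eq_bigr => i _; rewrite mxE.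
have t12 : 0 < t1 + t2 by rewrite addr_gt0.
have -> : u = (t2 / (t1 + t2)) *: (u + t1 *: w) +
    (t1 / (t1 + t2)) *: (u + t2 *: - w).
  apply/matrixP => i j; rewrite !mxE; by field; rewrite !gt_eqF.
by apply: (genD _ _ (genZ _ _ _ g1) (genZ _ _ _ g2)); rewrite divr_ge0 ?ltW.
Qed.

(** * Odd powers and odd roots *)

Lemma oddpow_ge0 {R : realType} (p : nat) (a : R) : (0 <= oddpow p a) = (0 <= a).
Proof. by rewrite /oddpow exprn_odd_ge0// addn1 oddS mul2n odd_double. Qed.

Lemma oddpowM {R : realType} (p : nat) (a b : R) :
  oddpow p (a * b) = oddpow p a * oddpow p b.
Proof. exact: exprMn. Qed.

Lemma oddpow0 {R : realType} (p : nat) : oddpow p 0 = 0 :> R.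
Proof. by rewrite /oddpow addn1 expr0n. Qed.

Lemma oddpowN {R : realType} (p : nat) (a : R) : oddpow p (- a) = - oddpow p a.
Proof. by rewrite /oddpow exprNn addn1 exprS exprM sqrrN expr1n expr1n mulr1 mulN1r. Qed.

Lemma oddpow_sign {R : realType} (p : nat) (b : bool) :
  oddpow p ((-1) ^+ b) = (-1) ^+ b :> R.
Proof. by case: b; rewrite /= ?expr1 ?oddpowN /oddpow ?expr0 expr1n. Qed.

Lemma oddpow_prod {R : realType} (I : finType) (p : nat) (f : I -> R) :
  oddpow p (\prod_i f i) = \prod_i oddpow p (f i).
Proof. by rewrite /oddpow prodrXl. Qed.

Lemma oddroot_ge0 {R : realType} (p : nat) (a : R) :
  (0 <= oddroot p a) = (0 <= a).
Proof. by rewrite -(oddpow_ge0 p) oddrootK. Qed.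

Lemma oddrootM {R : realType} (p : nat) (a z : R) :
  oddroot p (oddpow p a * z) = a * oddroot p z.
Proof. by apply: (can_inj (oddpowK p)); rewrite oddpowM !oddrootK. Qed.

Lemma oddroot0 {R : realType} (p : nat) : oddroot p 0 = 0 :> R.
Proof. by rewrite -[LHS](oddpowK p) oddrootK -[in LHS](oddpow0 p) oddpowK. Qed.

Lemma ler_oddroot {R : realType} (p : nat) (a b : R) :
  0 <= a -> a <= b -> oddroot p a <= oddroot p b.
Proof.
move=> a0 ab; have b0 := le_trans a0 ab.
rewrite -(@ler_pXn2r _ (2 * p + 1)) ?nnegrE ?oddroot_ge0// ?addn1//.
by rewrite -addn1 -!/(oddpow p _) !oddrootK.
Qed.

(** * Growth rates of sums of odd powers *)

Lemma cvg_oddroot_cst {R : realType} (c : R) :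
  0 < c -> oddroot p c @[p --> \oo] --> (1 : R).
Proof.
move=> c0.
have -> : (fun p => oddroot p c) = (fun p : nat => expR ((2 * p + 1)%:R^-1 * ln c)).
  by apply/funext => p; rewrite /oddroot gtr0_sg// mul1r gtr0_norm// /powR gt_eqF.
rewrite -[X in _ --> X]expR0; apply: continuous_cvg; first exact: continuous_expR.
rewrite -[X in _ --> X](mul0r (ln c)); apply: cvgMr_tmp.
have H : (p.+1%:R)^-1 @[p --> \oo] --> (0 : R) by exact: cvg_harmonic.
apply: squeeze_cvgr (cvg_cst 0) H.
near=> p; rewrite invr_ge0 ler0n/= lef_pV2 ?posrE ?ltr0n ?addn1// ler_nat.
by lia.
Unshelve. all: by end_near.
Qed.

Lemma cvg_oddroot_add {R : realType} {T : Type} (F : set_system T)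
    {FF : ProperFilter F} (p : T -> nat) (p_oo : p k @[k --> F] --> \oo)
    (h1 h2 : T -> R) (l1 l2 : R) :
  (\forall k \near F, 0 <= h1 k) -> (\forall k \near F, 0 <= h2 k) ->
  oddroot (p k) (h1 k) @[k --> F] --> l1 ->
  oddroot (p k) (h2 k) @[k --> F] --> l2 ->
  oddroot (p k) (h1 k + h2 k) @[k --> F] --> Num.max l1 l2.
Proof.
move=> h10 h20 c1 c2.
have cm : Num.max (oddroot (p k) (h1 k)) (oddroot (p k) (h2 k)) @[k --> F] -->
    Num.max l1 l2.
  under eq_fun do rewrite maxr_absE.
  rewrite maxr_absE; apply: cvgMr_tmp; apply: cvgD; first exact: cvgD.
  by apply: cvg_norm; exact: cvgB.
have c2m : oddroot (p k) 2 * Num.max (oddroot (p k) (h1 k)) (oddroot (p k) (h2 k))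
    @[k --> F] --> Num.max l1 l2.
  rewrite -[X in _ --> X]mul1r; apply: cvgM => //.
  by apply: (cvg_comp p (fun q => oddroot q 2) p_oo); exact: cvg_oddroot_cst.
apply: squeeze_cvgr cm c2m.
near=> k.
have a0 : 0 <= h1 k by near: k.
have b0 : 0 <= h2 k by near: k.
rewrite ge_max !ler_oddroot ?lerDl ?lerDr ?addr_ge0//=.
rewrite mulrC -oddrootM ler_oddroot ?addr_ge0//.
have [ab|/ltW ba] := leP (h1 k) (h2 k).
  rewrite max_r ?ler_oddroot// oddrootK; lra.
rewrite max_l ?ler_oddroot// oddrootK; lra.
Unshelve. all: by end_near.
Qed.

(** Growth rates are tropical on nonnegative sequences: a sum grows like its largest
    term.  The right-hand side does not see the filter or the exponents, so two
    sums with terms of equal growth rates have equal growth rates. *)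
Lemma cvg_oddroot_sum {R : realType} {T : Type} (F : set_system T)
    {FF : ProperFilter F} (p : T -> nat) (p_oo : p k @[k --> F] --> \oo)
    (I : finType) (h : I -> T -> R) (l : I -> R) :
  (forall i, \forall k \near F, 0 <= h i k) ->
  (forall i, oddroot (p k) (h i k) @[k --> F] --> l i) ->
  oddroot (p k) (\sum_i h i k) @[k --> F] --> \big[Num.max/0]_i l i.
Proof.
move=> h0 hl; rewrite /index_enum; elim: (Finite.enum _) => [|i s IH].
  rewrite big_nil; under eq_fun do rewrite big_nil oddroot0.
  exact: cvg_cst.
rewrite big_cons; under eq_fun do rewrite big_cons.
apply: (cvg_oddroot_add F p p_oo) => //.
elim: s {IH} => [|j s IH]; first by near=> k; rewrite big_nil.
near=> k; rewrite big_cons addr_ge0//; near: k => //.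
Unshelve. all: by end_near.
Qed.

Lemma cvg_oddpow0 {R : realType} (w : R) :
  `|w| < 1 -> oddpow p w @[p --> \oo] --> (0 : R).
Proof.
move=> w1.
have -> : (fun p => oddpow p w) = geometric w (w ^+ 2).
  by apply/funext => p; rewrite /oddpow/= addn1 exprS exprM.
by apply: cvg_geometric; rewrite normrX exprn_ilt1.
Qed.

(** Two opposite members of a family contribute nothing to any sum of odd powers and
    can be replaced by zeros.  Once no member is opposite to a member [l] of maximal
    absolute value, the sum divided by the odd power of [l] tends to the
    multiplicity of [l], and so [l] is the limit of the odd roots. *)
Lemma oddpow_sum_reduce {R : realType} (I : finType) (u : I -> R) :
  exists (v : I -> R) (l : R),
    [/\ forall p, \sum_i oddpow p (v i) = \sum_i oddpow p (u i),
        forall i, `|v i| <= `|l|,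
        l != 0 -> exists i, v i = l
      & oddroot p (\sum_i oddpow p (u i)) @[p --> \oo] --> l].
Proof.
have [k] := ubnP #|[pred i | u i != 0]|.
elim: k u => // k IH u uk.
have [[i0 ui0]|/forallNP u0] := pselect (exists i, u i != 0); last first.
  have {}u0 i : u i = 0 by have /negP := u0 i; rewrite negbK => /eqP.
  exists u, 0; split => //; first by move=> i; rewrite u0.
    by rewrite eqxx.
  under eq_fun do (rewrite big1 ?oddroot0; last by move=> i _; rewrite u0 oddpow0).
  exact: cvg_cst.
case: (arg_maxP (fun i => `|u i|) (erefl (xpredT i0))) => i1 _ um0.
have um i : `|u i| <= `|u i1| by exact: um0.
have ui1 : u i1 != 0.
  by rewrite -normr_gt0 (lt_le_trans _ (um i0))// normr_gt0.
have [[i2 ui2]|/forallNP u0] := pselect (exists i, u i = - u i1).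
  have i12 : i2 != i1.
    by apply: contra_neq ui1 => E; move: ui2; rewrite E; lra.
  pose u' i := if (i == i1) || (i == i2) then 0 else u i.
  have Eu p : \sum_i oddpow p (u' i) = \sum_i oddpow p (u i).
    rewrite (bigD1 i1)//= (bigD1 i2)//= [RHS](bigD1 i1)//= [X in _ = _ + X](bigD1 i2)//=.
    rewrite /u' !eqxx orbT oddpow0 ui2 oddpowN addrA addr0 addrA subrr.
    congr (_ + _); apply: eq_bigr => i /andP[/negbTE-> /negbTE->] //.
  have [|v [l [vE vl lv lc]]] := IH u'.
    apply: (@leq_trans #|[pred i | u i != 0]|) => //.
    apply: proper_card; apply/properP; split.
      by apply/fintype.subsetP => i; rewrite !inE /u'; case: ifP => //; rewrite eqxx.
    by exists i1; rewrite !inE// /u' !eqxx.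
  exists v, l; split => //; first by move=> p; rewrite vE.
  by under eq_fun do rewrite -Eu.
exists u, (u i1); split => //; first by exists i1.
(* The scaled family has maximal absolute value 1 and does not contain -1. *)
pose w i := u i / u i1.
have -> : (fun p => oddroot p (\sum_i oddpow p (u i))) =
    (fun p => u i1 * oddroot p (\sum_i oddpow p (w i))).
  apply/funext => p; rewrite -oddrootM mulr_sumr; congr (oddroot p _).
  by apply: eq_bigr => i _; rewrite -oddpowM mulrC divfK.
rewrite -[X in _ --> X]mulr1; apply: cvgMl_tmp.
have wc i : oddpow p (w i) @[p --> \oo] --> ((w i == 1)%:R : R).
  have [->|w1] := eqVneq (w i) 1.
    by rewrite /oddpow; under eq_fun do rewrite expr1n; exact: cvg_cst.
  apply: cvg_oddpow0; rewrite lt_neqAle normf_div ler_pdivrMr ?normr_gt0//.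
  rewrite mul1r um// andbT.
  apply/eqP => E; have : `|w i| = 1 by rewrite /w normf_div.
  move=> /eqP; rewrite eqr_norml (negbTE w1)/= ler01 andbT => /eqP wN.
  by apply: (u0 i); rewrite -mulN1r -wN /w divfK.
have sc : (\sum_i oddpow p (w i)) @[p --> \oo] --> \sum_i ((w i == 1)%:R : R).
  by apply: cvg_big => [|i _]; [exact: add_continuous|exact: wc].
set C := \sum_i _ in sc.
have C1 : 1 <= C.
  rewrite /C (bigD1 i1)//= {1}/w divff// eqxx lerDl.
  by apply: sumr_ge0 => i _; exact: ler0n.
apply: (@squeeze_cvgr _ _ _ _ (fun p => oddroot p 2^-1) (fun p => oddroot p (C + 1))).
- near=> p.
  have a : 2^-1 < \sum_i oddpow p (w i).
    by near: p; apply: (cvgr_gt C) => //; lra.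
  have b : \sum_i oddpow p (w i) < C + 1.
    by near: p; apply: (cvgr_lt C) => //; lra.
  by rewrite !ler_oddroot//; lra.
- by apply: cvg_oddroot_cst; lra.
- by apply: cvg_oddroot_cst; lra.
Unshelve. all: by end_near.
Qed.

(** A sum of odd powers is zero for all exponents or has eventually the sign of its
    nonzero growth rate; hence its sign along one sequence of exponents determines
    its eventual sign. *)
Lemma oddpow_sum_sign {R : realType} {T : Type} (F : set_system T)
    {FF : ProperFilter F} (p : T -> nat) (p_oo : p k @[k --> F] --> \oo)
    (I : finType) (u : I -> R) :
  (\forall k \near F, 0 <= \sum_i oddpow (p k) (u i)) ->
  \forall q \near \oo, 0 <= \sum_i oddpow q (u i).
Proof.
move=> S0; have [v [l [vE vl lv lc]]] := oddpow_sum_reduce I u.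
have l0 : 0 <= l.
  apply: (@cvgr_to_ge _ F _ _ (fun k => oddroot (p k) (\sum_i oddpow (p k) (u i)))).
    exact: (cvg_comp p (fun q => oddroot q (\sum_i oddpow q (u i))) p_oo lc).
  by apply: filterS S0 => k; rewrite oddroot_ge0.
move: l0; rewrite le_eqVlt => /predU1P[l0|l0].
  near=> q; rewrite -vE sumr_ge0// => i _; rewrite oddpow_ge0.
  by have := vl i; rewrite -l0 normr0 normr_le0 => /eqP->.
near=> q; rewrite -(oddroot_ge0 q) ltW//; near: q.
exact: (cvgr_gt l lc 0 l0).
Unshelve. all: by end_near.
Qed.

(** * Replacing the weights by sums of odd powers *)

Definition ray_monomial {R : comPzRingType} {q m : nat} (V : 'M[R]_(q, 1 + m))
    (r : rayidx q m) (j : 'I_(1 + m)) (s : {perm 'I_(1 + m)}) : R :=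
  (-1) ^+ s * \prod_a (ray_mx V r (delta_mx 0 j)) a (s a).

(** Odd powers fix the signs and the entries 0 and 1 that the Leibniz formula
    brings in, so they pass inside each term of the determinant. *)
Lemma ray_oddpow {R : realType} {q m : nat} (V : 'M[R]_(q, 1 + m))
    (r : rayidx q m) (j : 'I_(1 + m)) (p : nat) :
  ray (map_mx (oddpow p) V) r j 0 = \sum_s oddpow p (ray_monomial V r j s).
Proof.
have E : ray_mx (map_mx (oddpow p) V) r (delta_mx 0 j) =
    map_mx (oddpow p) (ray_mx V r (delta_mx 0 j)).
  rewrite /ray_mx map_col_mx map_mxsub; congr (col_mx _ _).
  apply/matrixP => a b; rewrite !mxE oddpowM oddpow_sign; congr (_ * _).
  by case: (_ && _); rewrite ?oddpow0// /oddpow expr1n.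
rewrite mxE E; apply: eq_bigr => s _; rewrite oddpowM oddpow_sign oddpow_prod.
by congr (_ * _); apply: eq_bigr => a _; rewrite mxE.
Qed.

Lemma ultra_bounded_cvg {R : realType} {T : Type} (F : set_system T)
    {FU : UltraFilter F} (a : T -> R) (B : R) :
  (\forall k \near F, 0 <= a k <= B) -> exists2 g : R, 0 <= g & a k @[k --> F] --> g.
Proof.
move=> aB; have FF : ProperFilter F by exact: ultra_proper.
have [|g [g0B gc]] := @segment_compact R 0 B (a @ F) _.
  by apply: filterS aB => k; rewrite /= in_itv.
exists g; first by move: g0B; rewrite /= in_itv/= => /andP[].
move=> A gA; have [//|nA] := in_ultra_setVsetC (a @^-1` A) FU.
have /(_ (~` A) A nA gA)[z []] := gc.
by [].
Qed.

Lemma mul_ray_oddpow {R : realType} {q m : nat} (V : 'M[R]_(q, 1 + m))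
    (r : rayidx q m) (i : 'I_q) (p : nat) :
  (map_mx (oddpow p) V *m ray (map_mx (oddpow p) V) r) i 0 =
  \sum_(z : 'I_(1 + m) * {perm 'I_(1 + m)})
    oddpow p (V i z.1 * ray_monomial V r z.1 z.2).
Proof.
rewrite mxE -(pair_bigA _ (fun j s => oddpow p (V i j * ray_monomial V r j s)))/=.
apply: eq_bigr => j _; rewrite ray_oddpow mxE mulr_sumr.
by apply: eq_bigr => s _; rewrite oddpowM.
Qed.

Lemma oddpow_sum_cvg {R : realType} (I : finType) (u : I -> R) :
  exists2 l : R, oddroot p (\sum_i oddpow p (u i)) @[p --> \oo] --> l &
    (l = 0 -> forall p, \sum_i oddpow p (u i) = 0).
Proof.
have [v [l [vE vl _ lc]]] := oddpow_sum_reduce I u.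
exists l => // l0 p; rewrite -vE big1// => i _.
by have := vl i; rewrite l0 normr0 normr_le0 => /eqP->; rewrite oddpow0.
Qed.

(** The coefficients of [l k] on the rays may be replaced by the odd powers of their
    limiting growth rates [g] without changing the growth rate of any left-hand side
    of the system.  An ultrafilter decides at once which rays are used and makes
    the bounded sequences of growth rates converge. *)
Lemma oddroot_ray_limits {R : realType} {q m : nat} (V : 'M[R]_(q, 1 + m))
    (V_pointed : forall p u, in_cone (map_mx (oddpow p) V) u ->
       forall j, 0 <= u j 0)
    {T : Type} (F : set_system T) {FU : UltraFilter F}
    (P : T -> nat) (P_oo : P k @[k --> F] --> \oo) (l : T -> 'cV[R]_(1 + m)) :
  (\forall k \near F, in_cone (map_mx (oddpow (P k)) V) (l k)) ->
  (\forall k \near F, forall j, l k j 0 <= 1) ->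
  exists (g : rayidx q m -> R), forall i, exists2 L : R,
    oddroot (P k) ((map_mx (oddpow (P k)) V *m l k) i 0) @[k --> F] --> L &
    oddroot p ((map_mx (oddpow p) V *m
      \sum_r oddpow p (g r) *: ray (map_mx (oddpow p) V) r) i 0)
      @[p --> \oo] --> L.
Proof.
set W := fun p => map_mx (oddpow p) V => lC l1.
have FF : ProperFilter F by exact: ultra_proper.
have /choice[c cP] : forall k, exists c : rayidx q m -> R,
    in_cone (W (P k)) (l k) ->
    [/\ forall r, 0 <= c r,
        forall r, c r != 0 -> ray (W (P k)) r != 0 /\ in_cone (W (P k)) (ray (W (P k)) r)
      & l k = \sum_r c r *: ray (W (P k)) r].
  move=> k; have [kC|] := pselect (in_cone (W (P k)) (l k)); last by exists (fun=> 0).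
  by have [c cP] := ray_decomposition (W (P k)) (V_pointed (P k)) (l k) kC; exists c.
pose a r k := oddroot (P k) (c k r).
have cE r k : c k r = oddpow (P k) (a r k) by rewrite oddrootK.
have along_F (h : nat -> R) (d : R) : oddroot p (h p) @[p --> \oo] --> d ->
    oddroot (P k) (h (P k)) @[k --> F] --> d.
  by move=> hd; exact: (cvg_comp P (fun p => oddroot p (h p)) P_oo hd).
have a_cvg r : exists2 g : R, 0 <= g & a r k @[k --> F] --> g.
  (* A ray with an entry of nonzero growth rate d bounds its coefficient, since *)
  (* the weights are at most 1; any other ray vanishes and is never used. *)
  have [[j [d dc d0]]|N] := pselect (exists j, exists2 d : R,
      oddroot p (ray (W p) r j 0) @[p --> \oo] --> d & d != 0).
    apply: (@ultra_bounded_cvg _ _ _ _ _ (2 / `|d|)).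
    have d2 : `|d| / 2 < `|d| by rewrite gtr_pMr ?normr_gt0//; lra.
    have ray_gt : \forall k \near F,
        `|d| / 2 < `|oddroot (P k) (ray (W (P k)) r j 0)|.
      exact: cvgr_gt _ (cvg_norm (along_F (fun p => ray (W p) r j 0) d dc)) _ d2.
    near=> k.
    have kC : in_cone (W (P k)) (l k) by near: k.
    have kl1 : forall j, l k j 0 <= 1 by near: k.
    have : `|d| / 2 < `|oddroot (P k) (ray (W (P k)) r j 0)| by near: k.
    have [c0 c1 lE] := cP k kC.
    rewrite /a oddroot_ge0 c0/=.
    have [->|/c1[_ rC]] := eqVneq (c k r) 0; first by rewrite oddroot0 divr_ge0.
    have rj := V_pointed _ _ rC j.
    rewrite [ltRHS]ger0_norm ?oddroot_ge0// => dlt.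
    have : a r k * oddroot (P k) (ray (W (P k)) r j 0) <= 1.
      rewrite -oddrootM -cE -[leRHS](oddpowK (P k)) [oddpow _ 1]expr1n.
      rewrite ler_oddroot ?mulr_ge0// (le_trans _ (kl1 j))// lE summxE (bigD1 r)//=.
      rewrite [X in _ <= X + _]mxE lerDl sumr_ge0// => r' _; rewrite mxE.
      have [->|/c1[_ rC']] := eqVneq (c k r') 0; first by rewrite mul0r.
      by rewrite mulr_ge0// (V_pointed (P k)).
    rewrite -/(a r k) ler_pdivlMr ?normr_gt0// => ale.
    have a0 : 0 <= a r k by rewrite oddroot_ge0.
    nra.
  exists 0 => //; apply: (cvg_near_cst (0 : R)) => //.
  near=> k.
  have kC : in_cone (W (P k)) (l k) by near: k.
  have [_ c1 _] := cP k kC; rewrite /a.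
  have [->|/c1[/eqP r0 _]] := eqVneq (c k r) 0; first by rewrite oddroot0.
  case: r0; apply/matrixP => j j'; rewrite ord1 [RHS]mxE ray_oddpow.
  have [d dc dr] := oddpow_sum_cvg _ (ray_monomial V r j).
  apply: dr; apply: contrapT => /eqP d0; apply: N; exists j; exists d => //.
  by under eq_fun do rewrite ray_oddpow.
have /choice[g gP] : forall r, exists g : R, 0 <= g /\ a r k @[k --> F] --> g.
  by move=> r; have [g] := a_cvg r; exists g.
exists g => i.
pose E r p := (W p *m ray (W p) r) i 0.
have /choice[d dP] : forall r, exists d : R, oddroot p (E r p) @[p --> \oo] --> d.
  move=> r; have [d dc _] := oddpow_sum_cvg _
    (fun z : 'I_(1 + m) * {perm 'I_(1 + m)} => V i z.1 * ray_monomial V r z.1 z.2).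
  by exists d; under eq_fun do rewrite /E mul_ray_oddpow.
have cE_ge0 r : \forall k \near F, 0 <= c k r * E r (P k).
  near=> k.
  have kC : in_cone (W (P k)) (l k) by near: k.
  have [c0 c1 _] := cP k kC.
  have [->|/c1[_ rC]] := eqVneq (c k r) 0; first by rewrite mul0r.
  by rewrite mulr_ge0// rC.
exists (\big[Num.max/0]_r (g r * d r)).
  have lim : oddroot (P k) (\sum_r c k r * E r (P k)) @[k --> F] -->
      \big[Num.max/0]_r (g r * d r).
    apply: cvg_oddroot_sum => // r.
    under eq_fun do rewrite cE oddrootM.
    by apply: cvgM; [exact: (gP r).2|exact: along_F].
  apply: cvg_trans lim; apply: near_eq_cvg; near=> k.
  have kC : in_cone (W (P k)) (l k) by near: k.
  have [_ _ ->] := cP k kC.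
  rewrite mulmx_sumr summxE; congr oddroot; apply: eq_bigr => r _.
  by rewrite -scalemxAr mxE.
under eq_fun => p.
  rewrite mulmx_sumr summxE; under eq_bigr do rewrite -scalemxAr mxE.
  over.
apply: (cvg_oddroot_sum _ id) => [|r|r]; first exact: cvg_id.
(* A ray with g r <> 0 is used along F, hence lies in the cone along F, hence *)
(* satisfies the constraint for all large exponents. *)
- have [->|g0] := eqVneq (g r) 0; first by near=> p; rewrite oddpow0 mul0r.
  suff : \forall p \near \oo, 0 <= E r p.
    by apply: filterS => p; apply: mulr_ge0; rewrite oddpow_ge0 (gP r).1.
  have Er : \forall k \near F, 0 <= E r (P k).
    have [c0|c0] := in_ultra_setVsetC [set k | c k r != 0] FU.
      near=> k.
      have kC : in_cone (W (P k)) (l k) by near: k.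
      have [_ c1 _] := cP k kC.
      have /c1[_ rC] : c k r != 0 by near: k.
      exact: rC.
    move/eqP : g0; case; apply: (cvg_unique _ (gP r).2) => //.
    apply: cvg_near_cst; apply: filterS c0 => k /= /negP; rewrite negbK => /eqP.
    by rewrite /a => ->; rewrite oddroot0.
  under eq_near do rewrite /E mul_ray_oddpow.
  apply: (oddpow_sum_sign F P P_oo).
  by apply: filterS Er => k; rewrite /E mul_ray_oddpow.
- under eq_fun do rewrite oddrootM.
  by apply: cvgMl_tmp; exact: dP.
Unshelve. all: by end_near.
Qed.

(** * Convex combinations and index sets *)

Lemma convex_hull_range {R : realType} {n m : nat} (x : 'I_m -> 'rV[R]_n)
    (z : 'rV[R]_n) :
  convex_hull (range x) z ->
  exists l : 'cV[R]_m, [/\ forall j, 0 <= l j 0, \sum_j l j 0 = 1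
    & forall i, z 0 i = \sum_j l j 0 * x j 0 i].
Proof.
pose X := [set z : 'rV[R]_n | exists l : 'cV[R]_m, [/\ forall j, 0 <= l j 0,
  \sum_j l j 0 = 1 & forall i, z 0 i = \sum_j l j 0 * x j 0 i]].
suff H : convex_hull (range x) `<=` X by move=> /H.
apply: smallest_sub => [u v t|_ [j _ <-]].
  move=> /set_mem[l [l0 l1 lE]] /set_mem[h [h0 h1 hE]]; apply/mem_set.
  exists (t%:num *: l + (1 - t%:num) *: h); split.
  - by move=> j; rewrite !mxE addr_ge0// mulr_ge0// subr_ge0.
  - under eq_bigr do rewrite !mxE.
    by rewrite big_split/= -!mulr_sumr l1 h1 !mulr1 subrKC.
  - move=> i; rewrite /conv/= !mxE lE hE !mulr_sumr -big_split/=.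
    by apply: eq_bigr => j _; rewrite !mxE /unstable.onem; ring.
exists (delta_mx j 0); split.
- by move=> k; rewrite mxE andbT ler0n.
- rewrite (bigD1 j)//= mxE !eqxx big1 ?addr0// => k kj.
  by rewrite mxE (negbTE kj).
- move=> i; rewrite (bigD1 j)//= mxE !eqxx mul1r big1 ?addr0// => k kj.
  by rewrite mxE (negbTE kj) mul0r.
Qed.

Lemma finType_fset_nat (K : finType) :
  exists (J : {fset nat}) (h : J -> K), bijective h.
Proof.
pose J : {fset nat} := [fset i in iota 0 #|K|]%fset.
have E : #|{: J}| = #|K|.
  by rewrite -cardfE card_fseq undup_id ?iota_uniq// size_iota.
exists J, (fun z => enum_val (cast_ord E (enum_rank z))).
apply: bij_comp; first exact: enum_val_bij.
apply: bij_comp; last exact: enum_rank_bij.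
by exists (cast_ord (esym E)); [exact: cast_ordK|exact: cast_ordKV].
Qed.

Lemma increasing_seq_cvg (q : nat -> nat) :
  increasing_seq q -> q k @[k --> \oo] --> \oo.
Proof.
move=> qi; have kq k : (k <= q k)%N.
  elim: k => // k IH; apply: (leq_ltn_trans IH).
  by rewrite ltnNge; have := qi k.+1 k; rewrite leEnat => ->; rewrite -ltnNge.
apply/cvgnyPge => A; near=> k; apply: leq_trans (kq k); near: k.
exact: nbhs_infty_ge.
Unshelve. all: by end_near.
Qed.

(** * The upper limit of the hulls *)

Lemma Cop_range {R : realType} {n m : nat} (p : nat) (x : 'I_m -> 'rV[R]_n)
    (z : 'rV[R]_n) :
  Cop p (range x) z ->
  exists l : 'cV[R]_m, [/\ forall j, 0 <= l j 0, \sum_j l j 0 = 1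
    & forall i, oddpow p (z 0 i) = \sum_j l j 0 * oddpow p (x j 0 i)].
Proof.
rewrite /Cop /= image_comp => /convex_hull_range[l [l0 l1 lE]].
exists l; split => // i; have := lE i; rewrite mxE => ->.
by apply: eq_bigr => j _; rewrite mxE.
Qed.

(** The identity block makes the cone pointed and also gives access to the single
    weights as left-hand sides of the system. *)
Definition signed_system {R : pzRingType} {n m : nat} (s : 'I_n -> bool)
    (x : 'I_m -> 'rV[R]_n) : 'M[R]_(m + n, m) :=
  col_mx 1%:M (\matrix_(i, j) ((-1) ^+ s i * x j 0 i)).

Lemma signed_system_up {R : realType} {n m : nat} (s : 'I_n -> bool)
    (x : 'I_m -> 'rV[R]_n) (p : nat) (u : 'cV[R]_m) (j : 'I_m) :
  (map_mx (oddpow p) (signed_system s x) *m u) (lshift n j) 0 = u j 0.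
Proof.
rewrite map_col_mx mul_col_mx col_mxEu.
have -> : map_mx (oddpow p) 1%:M = 1%:M :> 'M[R]_m; last by rewrite mul1mx.
apply/matrixP => a b; rewrite !mxE.
by case: (a == b); rewrite ?oddpow0// /oddpow expr1n.
Qed.

Lemma signed_system_down {R : realType} {n m : nat} (s : 'I_n -> bool)
    (x : 'I_m -> 'rV[R]_n) (p : nat) (u : 'cV[R]_m) (i : 'I_n) :
  (map_mx (oddpow p) (signed_system s x) *m u) (rshift m i) 0 =
  (-1) ^+ s i * \sum_j u j 0 * oddpow p (x j 0 i).
Proof.
rewrite map_col_mx mul_col_mx col_mxEd mxE mulr_sumr.
apply: eq_bigr => j _; rewrite !mxE oddpowM oddpow_sign.
by rewrite -mulrA [oddpow _ _ * _]mulrC.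
Qed.

(** The families of coefficients, indexed by candidate rays and permutations, before
    their transport to sets of natural numbers.  The limits are stated with
    existence because [boxplus] is a bare [lim]. *)
Lemma Co_infty_coefficients {R : realType} {n m : nat}
    (x : 'I_(1 + m) -> 'rV[R]_n) (y : 'rV[R]_n) :
  Co_infty (range x) y ->
  exists v : 'I_(1 + m) ->
      rayidx (1 + m + n) m * {perm 'I_(1 + m)} -> R,
    [/\ forall i, oddroot p (\sum_j \sum_k oddpow p (v j k * x j 0 i))
          @[p --> \oo] --> y 0 i,
        forall j, exists2 L : R, 0 <= L &
          oddroot p (\sum_k oddpow p (v j k)) @[p --> \oo] --> L,
        exists j k, v j k = 1
      & forall j k, v j k <= 1].
Proof.
move=> [P [z [Pinc zC zy]]].
have [F [FU Foo]] := ultraFilterLemma eventually_filter.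
have FF : ProperFilter F by exact: ultra_proper.
have P_oo : P k @[k --> F] --> \oo.
  by apply: cvg_trans (increasing_seq_cvg P Pinc); move=> A; exact: Foo.
have z_cvg i : z k 0 i @[k --> F] --> y 0 i.
  have H : z k 0 i @[k --> \oo] --> y 0 i.
    exact: (continuous_cvg _ (@coord_continuous _ _ _ 0 i y) zy).
  by apply: cvg_trans H; move=> A; exact: Foo.
have /choice[l lP] : forall k, exists l : 'cV[R]_(1 + m),
    [/\ forall j, 0 <= l j 0, \sum_j l j 0 = 1 &
    forall i, oddpow (P k) (z k 0 i) = \sum_j l j 0 * oddpow (P k) (x j 0 i)].
  by move=> k; exact: Cop_range (zC k).
have /choice[s sP] : forall i, exists b : bool,
    \forall k \near F, 0 <= (-1) ^+ b * z k 0 i.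
  move=> i; have [z0|z0] := in_ultra_setVsetC [set k | 0 <= z k 0 i] FU.
    by exists false; apply: filterS z0 => k /=; rewrite mul1r.
  exists true; apply: filterS z0 => k /= /negP.
  by rewrite -ltNge mulN1r oppr_ge0 => /ltW.
pose V := signed_system s x.
have V_pointed p u : in_cone (map_mx (oddpow p) V) u -> forall j, 0 <= u j 0.
  by move=> uC j; have := uC (lshift n j); rewrite signed_system_up.
have down k i : (map_mx (oddpow (P k)) V *m l k) (rshift (1 + m) i) 0 =
    oddpow (P k) ((-1) ^+ s i * z k 0 i).
  have [_ _ lE] := lP k.
  by rewrite signed_system_down -lE oddpowM oddpow_sign.
have lC : \forall k \near F, in_cone (map_mx (oddpow (P k)) V) (l k).
  have sF : \forall k \near F, forall i, 0 <= (-1) ^+ s i * z k 0 i.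
    exact: filter_forall.
  near=> k => r; have [l0 _ _] := lP k.
  have sk : forall i, 0 <= (-1) ^+ s i * z k 0 i by near: k.
  by case: (split_ordP r) => [j|i] ->; rewrite ?signed_system_up// down oddpow_ge0.
have l1 : \forall k \near F, forall j, l k j 0 <= 1.
  near=> k => j; have [l0 <- _] := lP k.
  by rewrite (bigD1 j)//= lerDl sumr_ge0.
have [g gP] := oddroot_ray_limits V V_pointed F P P_oo l lC l1.
pose t (j : 'I_(1 + m)) (k : rayidx (1 + m + n) m * {perm 'I_(1 + m)}) :=
  g k.1 * ray_monomial V k.1 j k.2.
pose N p := \sum_r oddpow p (g r) *: ray (map_mx (oddpow p) V) r.
have tE p j : \sum_k oddpow p (t j k) = N p j 0.
  rewrite /N summxE.
  rewrite -(pair_bigA _ (fun r s => oddpow p (g r * ray_monomial V r j s)))/=.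
  apply: eq_bigr => r _; rewrite [RHS]mxE ray_oddpow mulr_sumr.
  by apply: eq_bigr => q _; rewrite oddpowM.
have /choice[v vP] : forall j, exists v : rayidx (1 + m + n) m * {perm 'I_(1 + m)} -> R,
    (forall p, \sum_k oddpow p (v k) = \sum_k oddpow p (t j k)) /\
    exists L : R, [/\ forall k, `|v k| <= `|L|, L != 0 -> exists k, v k = L &
      oddroot p (\sum_k oddpow p (t j k)) @[p --> \oo] --> L].
  move=> j; have [v [L [vE vL vex vc]]] := oddpow_sum_reduce _ (t j).
  by exists v; split => //; exists L.
have /choice[L LP] : forall j, exists L : R,
    [/\ forall k, `|v j k| <= `|L|, L != 0 -> exists k, v j k = L &
      oddroot p (\sum_k oddpow p (t j k)) @[p --> \oo] --> L].
  by move=> j; have [_] := vP j.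
have l_cvg j : oddroot (P k) (l k j 0) @[k --> F] --> L j.
  have [M] := gP (lshift n j).
  under eq_fun do rewrite signed_system_up.
  under [in X in _ -> X -> _]eq_fun do rewrite signed_system_up -tE.
  move=> lM tM; have [_ _ tL] := LP j.
  by rewrite (cvg_unique _ tL tM).
have L0 j : 0 <= L j.
  apply: (cvgr_to_ge (l_cvg j)); near=> k.
  by rewrite oddroot_ge0; have [] := lP k.
have maxL : \big[Num.max/0]_j L j = 1.
  have H : oddroot (P k) (\sum_j l k j 0) @[k --> F] --> \big[Num.max/0]_j L j.
    apply: (cvg_oddroot_sum _ P P_oo) => // j; near=> k.
    by have [] := lP k.
  apply: (cvg_unique _ H) => //; apply: cvg_near_cst; near=> k.
  have [_ -> _] := lP k; apply: (can_inj (oddpowK (P k))).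
  by rewrite oddrootK /oddpow expr1n.
have L1 j : L j <= 1 by rewrite -maxL le_bigmax.
exists v; split.
- move=> i; have [M] := gP (rshift (1 + m) i).
  under eq_fun do rewrite down oddpowK.
  under [in X in _ -> X -> _]eq_fun do rewrite signed_system_down.
  move=> zM NM.
  have zs : (-1) ^+ s i * z k 0 i @[k --> F] --> (-1) ^+ s i * y 0 i.
    by apply: cvgMl_tmp; exact: z_cvg.
  have yE : y 0 i = (-1) ^+ s i * M.
    by rewrite (cvg_unique _ zM zs)// signrMK.
  rewrite yE.
  have -> : (fun p => oddroot p (\sum_j \sum_k oddpow p (v j k * x j 0 i))) =
      fun p => (-1) ^+ s i *
        oddroot p ((-1) ^+ s i * \sum_j N p j 0 * oddpow p (x j 0 i)).
    apply/funext => p; rewrite -oddrootM oddpow_sign signrMK; congr oddroot.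
    apply: eq_bigr => j _; rewrite -tE -(vP j).1 mulr_suml.
    by apply: eq_bigr => k _; rewrite oddpowM.
  by apply: cvgMl_tmp; exact: NM.
- move=> j; exists (L j) => //; have [_ _] := LP j.
  by under eq_fun do rewrite -(vP j).1.
- have [j Lj] : exists j, 1 <= L j.
    apply: contrapT => /forallNP N1.
    suff : \big[Num.max/0]_j L j < 1 by rewrite maxL ltxx.
    by apply: bigmax_lt => // j _; rewrite ltNge; apply/negP/N1.
  have L1j : L j = 1 by apply/eqP; rewrite eq_le L1.
  have [_ Lex _] := LP j; have [|k vk] := Lex; first by rewrite L1j oner_eq0.
  by exists j, k; rewrite vk.
- move=> j k; have [vL _ _] := LP j.
  by rewrite (le_trans (ler_norm _))// (le_trans (vL k))// ger0_norm.
Unshelve. all: by end_near.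
Qed.

Theorem proposition3p2p6 (R : realType) (n m : nat) (hn : (0 < n)%N)
    (hm : (0 < m)%N) (x : 'I_m -> 'rV[R]_n) :
  exists I : 'I_m -> {fset nat},
    Co_infty (range x) `<=`
    [set y | exists t : forall j : 'I_m, I j -> R,
      [/\ y = boxplus_row (fun s : {j : 'I_m & I j} =>
                             t (tag s) (tagged s) *: x (tag s)),
          forall j : 'I_m, 0 <= boxplus (t j)
        & is_max_of (fun s : {j : 'I_m & I j} => t (tag s) (tagged s)) 1]].
Proof.
case: m hm x => // m _ x.
have [J [h h_bij]] :=
  finType_fset_nat (rayidx (1 + m + n) m * {perm 'I_(1 + m)})%type.
exists (fun=> J) => y /Co_infty_coefficients[v [v_y v_ge0 [j1 [k1 v1]] v_le1]].
exists (fun j k => v j (h k)).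
have hsum (f : _ -> R) : \sum_(k : J) f (h k) = \sum_k f k.
  by rewrite [RHS](reindex h)//; exact: onW_bij.
split.
- apply/rowP => i; rewrite mxE; apply/esym/cvg_lim => //.
  under eq_fun => p.
    under eq_bigr do rewrite mxE.
    rewrite -(sig_big_dep xpredT (fun=> xpredT)
      (fun (j : 'I_m.+1) (k : J) => oddpow p (v j (h k) * x j 0 i)))/=.
    under eq_bigr do rewrite (hsum (fun k => oddpow p (v _ k * x _ 0 i))).
    over.
  exact: v_y.
- move=> j; have [L L0 vL] := v_ge0 j.
  suff -> : boxplus (fun k : J => v j (h k)) = L by [].
  apply: cvg_lim => //.
  by under eq_fun do rewrite (hsum (fun k => oddpow _ (v j k))).
- split; last by move=> [j k]; exact: v_le1.
  have [h' _ h'K] := h_bij.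
  by exists (existT (fun _ : 'I_m.+1 => J : Type) j1 (h' k1)); rewrite /= h'K.
Qed.
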